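(* Let $T>0$, let $f\colon\mathbb{R}\to\mathbb{R}$ be continuous and $T$-periodic, and let $\alpha\in(0,1)$. Then the fractional integral $I^\alpha f$ is a bounded function if, and only if, $$\int_0^T f(t)\,dt=0.$$
   Context: For $\alpha>0$, the fractional integral of order $\alpha$ of $f$ is $I^\alpha f(t)=\dfrac{1}{\Gamma(\alpha)}\displaystyle\int_0^t (t-s)^{\alpha-1}f(s)\,ds$ for $t>0$. Boundedness refers to boundedness on the half-line of positive $t$. *)

(* Defs.v *)
From mathcomp Require Export all_boot all_order all_algebra.
From mathcomp Require Export all_classical all_reals all_analysis.

Set Implicit Arguments.
Unset Strict Implicit.
Unset Printing Implicit Defensive.

Export Order.TTheory GRing.Theory Num.Theory.
Export numFieldNormedType.Exports.

Local Open Scope classical_set_scope.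
Local Open Scope ring_scope.

(* In ring_scope, \int is the real-valued Lebesgue integral, which is 0 by
   convention when the integral is infinite; the one below is finite for a > 0.
   The domains of integration here exclude the point where the power is
   singular, at which powR takes the conventional value 0. *)
Definition Gamma (R : realType) (a : R) : R :=
  \int[lebesgue_measure]_(x in `]0, +oo[) (x `^ (a - 1) * expR (- x)).

(* For a > 0, t > 0 and f continuous the integrand is absolutely integrable. *)
Definition frac_integral (R : realType) (a : R) (f : R -> R) (t : R) : R :=
  (Gamma a)^-1 *
  \int[lebesgue_measure]_(s in `]0, t[) ((t - s) `^ (a - 1) * f s).

(* Main.v *)
From mathcomp Require Import lra ring measurable_realfun.
Require Import Defs.

(** Write m for the mean of f over one period and g = f - m, so that
    I^a f = I^a g + m I^a 1. Everything follows from two facts.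

    I^a 1 is unbounded: on ]0, t[ the kernel (t - s)^(a - 1) is at least
    t^(a - 1), so its integral is at least t^a ([Rintegral_powR_sub_ge]).

    I^a g is bounded, because g has mean zero. Indeed a primitive F of g is then
    periodic ([periodic_primitive]), hence bounded. Cut ]0, t[ at t - 1. On
    ]t - 1, t[ the kernel is singular but has integral at most 1 / a, so
    boundedness of g is enough ([normr_Rintegral_powR_subM_le]). On
    [0, t - 1] the kernel is smooth, increasing and at most 1; integrating by
    parts moves the derivative from F to the kernel, and the total variation of
    the kernel is at most 1, so the contribution is controlled by sup |F|
    uniformly in t ([normr_Rintegral_monotoneM_le]). The two pieces are put
    together in [normr_fractional_integral_le].

    So if m = 0 then I^a f = I^a g is bounded, and if I^a f is bounded then so is
    m I^a 1, which forces m = 0. This last step divides by 1 / Gamma(a), so it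
    needs Gamma(a) > 0; as the real-valued integral of a non-integrable function
    is 0, that amounts to the integrability of the Gamma integrand
    ([integrable_Gamma]). *)

Set Implicit Arguments.
Unset Strict Implicit.
Unset Printing Implicit Defensive.

Local Open Scope classical_set_scope.
Local Open Scope ring_scope.

Local Notation mu := lebesgue_measure.

(** * The fundamental theorem of calculus for a possibly singular derivative *)

Section antiderivatives.
Context {R : realType}.
Implicit Types (f F : R -> R) (c d x y K : R).

Lemma is_derive_continuous F x (l : R) :
  is_derive x 1 F l -> {for x, continuous F}.
Proof.
move=> dF; apply: differentiable_continuous.
by apply/derivable1_diffP; exact: ex_derive.
Qed.

Lemma is_derive_LRcontinuous F f x y : x <= y ->
  (forall z, x <= z <= y -> is_derive z 1 F (f z)) ->
  derivable_oo_LRcontinuous F x y.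
Proof.
move=> xy dF.
have cF z : x <= z <= y -> {for z, continuous F}.
  by move=> /dF; exact: is_derive_continuous.
split.
- move=> z /[!in_itv]/= /andP[/ltW xz /ltW zy].
  by have := dF z; rewrite xz zy => /(_ isT) ?; exact: ex_derive.
- by apply: cvg_at_right_filter; apply: cF; rewrite lexx.
- by apply: cvg_at_left_filter; apply: cF; rewrite lexx andbT.
Qed.

Lemma is_derive_derive1 F f x y :
  (forall z, x <= z <= y -> is_derive z 1 F (f z)) ->
  {in `]x, y[, F^`()%classic =1 f}.
Proof.
move=> dF z /[!in_itv]/= /andP[/ltW xz /ltW zy].
have := dF z; rewrite xz zy => /(_ isT) ?.
by rewrite derive1E; exact: derive_val.
Qed.

Lemma integral_is_derive F f x y : x <= y ->
  (forall z, x <= z <= y -> is_derive z 1 F (f z)) ->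
  {within `[x, y], continuous f} ->
  (\int[mu]_(z in `[x, y]) (f z)%:E)%E = (F y - F x)%:E.
Proof.
rewrite le_eqVlt => /predU1P[->{x} _ _|xy dF cf].
  by rewrite set_itv1 integral_set1 subrr.
rewrite (continuous_FTC2 xy cf _ (is_derive_derive1 dF))//.
exact: is_derive_LRcontinuous (ltW xy) dF.
Qed.

(** All conditions bear on the open interval, so this reaches the singular end
    of a power kernel. A nonnegative integrand is exhausted from inside by
    compact intervals, where the usual theorem applies; a bound K on the
    increments of F passes to the limit by monotone convergence. *)
Lemma le_integral_is_derive_oo F f c d K : c < d ->
  (forall z, c < z < d -> is_derive z 1 F (f z)) ->
  {in `]c, d[, continuous f} ->
  (forall z, c < z < d -> 0 <= f z) ->
  (forall x y, c < x -> x < y -> y < d -> F y - F x <= K) ->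
  (\int[mu]_(z in `]c, d[) (f z)%:E <= K%:E)%E.
Proof.
move=> cd dF cf f0 FK.
(* The margin e n tends to 0; the denominator n + 3 makes it less than half the
   length of ]c, d[ already for n = 0. *)
pose e (n : nat) := (d - c) / (n%:R + 3).
have dc0 : 0 < d - c by rewrite subr_gt0.
have n3 n : 0 < n%:R + 3 :> R by rewrite ltr_wpDl.
have e0 n : 0 < e n by rewrite divr_gt0.
have e3 n : e n <= (d - c) / 3.
  by rewrite ler_pM2l// lef_pV2 ?posrE// lerDr.
pose A n := `[c + e n, d - e n]%classic.
have AE : `]c, d[%classic = \bigcup_n A n.
  apply/seteqP; split => x /=.
    rewrite in_itv/= => /andP[cx xd].
    pose r := Num.min (x - c) (d - x).
    have r0 : 0 < r by rewrite lt_min !subr_gt0 cx xd.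
    exists (Num.truncn ((d - c) / r)).+1 => //; rewrite /A/= in_itv/=.
    set n := (Num.truncn _).+1.
    have : e n <= r.
      rewrite /e ler_pdivrMr// mulrC -ler_pdivrMr//.
      rewrite (le_trans (ltW (truncnS_gt _)))// lerDl//.
    by rewrite le_min => /andP[]; rewrite lerBrDl lerBrDr -lerBrDl => -> ?; lra.
  move=> [n _]; rewrite /A/= !in_itv/= => /andP[h1 h2]; have := e0 n => ?.
  by apply/andP; split; lra.
have sub n x : A n x -> c < x < d.
  by move=> Ax; have : (\bigcup_n A n) x by [exists n]; rewrite -AE /= in_itv.
have cfA n : {within A n, continuous f}.
  apply: (@continuous_subspaceW _ _ _ `]c, d[).
    by move=> x /sub/=; rewrite in_itv.
  by rewrite continuous_open_subspace// => x /set_mem /cf.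
rewrite AE; apply: (@cvge_le _ \oo%classic _ _ (fun n => \int[mu]_(z in A n) (f z)%:E)%E).
  near=> n.
  have -> : (\int[mu]_(z in A n) (f z)%:E)%E = (F (d - e n) - F (c + e n))%:E.
    apply: integral_is_derive.
    - by have := e3 n => ?; lra.
    - by move=> z zA; apply: dF; apply: (sub n); rewrite /A /= in_itv.
    - exact: cfA.
  by rewrite lee_fin; have := e0 n; have := e3 n => ? ?; apply: FK; lra.
apply: ge0_nondecreasing_set_cvg_integral => //.
- move=> n m nm; apply/subsetPset => x; rewrite /A/= !in_itv/=.
  have : e m <= e n by rewrite ler_pM2l// lef_pV2 ?posrE// lerD2r ler_nat.
  by move=> ? /andP[? ?]; apply/andP; split; lra.
- by move=> n; rewrite /A; exact: measurable_itv.
- move=> n; apply/measurable_EFinP; apply: subspace_continuous_measurable_fun; last exact: cfA.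
  exact: measurable_itv.
- by move=> n x /sub/f0; rewrite lee_fin.
Unshelve. all: by end_near. Qed.

Lemma integrable_is_derive_oo F f c d K : c < d ->
  (forall z, c < z < d -> is_derive z 1 F (f z)) ->
  {in `]c, d[, continuous f} ->
  (forall z, c < z < d -> 0 <= f z) ->
  (forall x y, c < x -> x < y -> y < d -> F y - F x <= K) ->
  (@mu R).-integrable `]c, d[ (EFin \o f).
Proof.
move=> cd dF cf f0 FK; apply/integrableP; split.
  apply/measurable_EFinP; apply: open_continuous_measurable_fun.
    by apply: interval_open.
  by move=> x /set_mem/cf.
have -> : (\int[mu]_(z in `]c, d[) `|(EFin \o f) z|
    = \int[mu]_(z in `]c, d[) (f z)%:E)%E.
  apply: eq_integral => z /[!inE]/=.
  by rewrite in_itv/= => /f0 fz; rewrite ger0_norm.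
by apply: le_lt_trans (ltry K); exact: le_integral_is_derive_oo dF cf f0 FK.
Qed.

End antiderivatives.

(** * Power kernels and the Gamma function *)

Section kernel.
Context {R : realType}.
Implicit Types (a c s t x y : R).

Lemma is_derive_powR_sub t a s : s < t ->
  is_derive s 1 (fun z : R => (t - z) `^ a) (- (a * (t - s) `^ (a - 1))).
Proof.
move=> st; rewrite -[X in is_derive _ _ _ X]mulrN1.
have dts : is_derive (t - s) 1 (@powR R ^~ a) (a * (t - s) `^ (a - 1)).
  by apply: is_derive1_powR; rewrite subr_gt0.
have dt : is_derive s 1 (fun z : R => t - z) (- 1).
  by apply: is_derive_eq; ring.
exact: (is_derive1_comp (f := @powR R ^~ a) (g := fun z : R => t - z) dts dt).
Qed.

Lemma continuous_powR_sub t a s : s < t ->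
  {for s, continuous (fun z : R => (t - z) `^ a)}.
Proof. by move=> st; exact: is_derive_continuous (is_derive_powR_sub a st). Qed.

Lemma powR_le_mono a x y : 0 <= a -> 0 <= x -> x <= y -> x `^ a <= y `^ a.
Proof.
by move=> a0 x0 xy; apply: ge0_ler_powR => //; rewrite nnegrE// (le_trans x0).
Qed.

(* For a > 0 this primitive stays bounded up to the singularity s = t, so its
   increments satisfy the hypothesis of the improper fundamental theorem. *)
Let kernel_primitive t a s := - a^-1 * (t - s) `^ a.

Let is_derive_kernel_primitive t a s : 0 < a -> s < t ->
  is_derive s 1 (kernel_primitive t a) ((t - s) `^ (a - 1)).
Proof.
move=> a0 st; have dp := is_derive_powR_sub a st.
rewrite /kernel_primitive; apply: is_derive_eq.
by rewrite /GRing.scale/= mulrNN mulKf// gt_eqF.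
Qed.

Let kernel_primitive_le t a c x y : 0 < a -> c < x -> x < y -> y < t ->
  kernel_primitive t a y - kernel_primitive t a x <= (t - c) `^ a / a.
Proof.
move=> a0 cx xy yt; rewrite /kernel_primitive !mulNr opprK addrC -mulrBr mulrC.
rewrite ler_pM2r ?invr_gt0// (@le_trans _ _ ((t - x) `^ a)) //.
  by rewrite gerBl powR_ge0.
by apply: powR_le_mono; [exact: ltW|lra|lra].
Qed.

Lemma integrable_powR_sub t a c : 0 < a -> c < t ->
  (@mu R).-integrable `]c, t[ (EFin \o (fun s => (t - s) `^ (a - 1))).
Proof.
move=> a0 ct.
apply: (integrable_is_derive_oo ct (F := kernel_primitive t a)).
- by move=> z /andP[_ zt]; exact: is_derive_kernel_primitive.
- by move=> z; rewrite in_itv => /andP[_]; exact: continuous_powR_sub.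
- by move=> z _; exact: powR_ge0.
- by move=> x y; exact: kernel_primitive_le.
Qed.

Lemma Rintegral_powR_sub_le t a c : 0 < a -> c < t ->
  \int[mu]_(s in `]c, t[) ((t - s) `^ (a - 1)) <= (t - c) `^ a / a.
Proof.
move=> a0 ct; rewrite -lee_fin /Rintegral fineK; last first.
  exact: (integrable_fin_num _ (integrable_powR_sub a0 ct)).
apply: (le_integral_is_derive_oo ct (F := kernel_primitive t a)).
- by move=> z /andP[_ zt]; exact: is_derive_kernel_primitive.
- by move=> z; rewrite in_itv => /andP[_]; exact: continuous_powR_sub.
- by move=> z _; exact: powR_ge0.
- by move=> x y; exact: kernel_primitive_le.
Qed.

(** The kernel is nondecreasing in s as a <= 1, hence at least its value at
    s = 0. This crude bound already grows without limit in t. *)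
Lemma Rintegral_powR_sub_ge t a : 0 < a <= 1 -> 0 < t ->
  t `^ a <= \int[mu]_(s in `]0, t[) ((t - s) `^ (a - 1)).
Proof.
move=> /andP[a0 a1] t0.
have <- : \int[mu]_(s in `]0, t[) (t `^ (a - 1)) = t `^ a.
  rewrite Rintegral_cst//= lebesgue_measure_itv/= lte_fin t0 oppr0 addr0.
  by rewrite mulrC mulr_powRB1// ltW.
apply: le_Rintegral => //=.
- apply: measurable_bounded_integrable => //.
    by rewrite /= lebesgue_measure_itv/= lte_fin t0 -EFinB ltry.
  exact: bounded_cst.
- exact: integrable_powR_sub.
move=> s; rewrite in_itv/= => /andP[s0 st].
rewrite -opprB !powRN lef_pV2 ?posrE ?powR_gt0 ?subr_gt0//.
by apply: powR_le_mono; lra.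
Qed.

Lemma integrable_powR_near0 a :
  0 < a -> (@mu R).-integrable `]0, 1[ (EFin \o (@powR R ^~ (a - 1))).
Proof.
move=> a0.
apply: (@integrable_is_derive_oo _ (fun x => a^-1 * x `^ a) _ 0 1 a^-1) => //.
- move=> z /andP[z0 z1]; have dz := is_derive1_powR a z0.
  apply: is_derive_eq.
  by rewrite /GRing.scale/= mulKf// gt_eqF.
- move=> z; rewrite in_itv/= => /andP[z0 _].
  exact: is_derive_continuous (is_derive1_powR (a - 1) z0).
- by move=> z _; exact: powR_ge0.
move=> x y x0 xy y1; rewrite -mulrBr ger_pMr ?invr_gt0//.
have : y `^ a <= 1.
  by have := @powR_le_mono a y 1 (ltW a0); rewrite powR1; apply; lra.
by have := powR_ge0 x a; lra.
Qed.

Lemma powR_sub1_le1 a x : a <= 1 -> 1 <= x -> x `^ (a - 1) <= 1.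
Proof.
move=> a1 x1; rewrite -opprB powRN invf_le1 ?powR_gt0 ?(lt_le_trans ltr01)//.
by have := @powR_le_mono (1 - a) 1 x; rewrite powR1; apply; lra.
Qed.

Lemma powR_sub1_ge1 a x : a <= 1 -> 0 < x -> x <= 1 -> 1 <= x `^ (a - 1).
Proof.
move=> a1 x0 x1; rewrite -opprB powRN invf_ge1 ?powR_gt0//.
by have := @powR_le_mono (1 - a) x 1; rewrite powR1; apply; lra.
Qed.

(** The integrand is dominated by x^(a - 1) on ]0, 1[ and by exp(- x) on [1, +oo[;
    the latter is the density of the exponential distribution of rate 1. *)
Lemma integrable_Gamma a : 0 < a <= 1 ->
  (@mu R).-integrable `]0, +oo[ (EFin \o (fun x => x `^ (a - 1) * expR (- x))).
Proof.
move=> /andP[a0 a1].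
pose h x := ((@powR R ^~ (a - 1)) \_ `]0, 1[) x + exponential_pdf 1 x.
have ih : (@mu R).-integrable setT (EFin \o h).
  have ip : (@mu R).-integrable setT (EFin \o ((@powR R ^~ (a - 1)) \_ `]0, 1[)).
    rewrite -restrict_EFin; apply/integrable_restrict => //=.
    by rewrite setTI; exact: integrable_powR_near0.
  have := integrableD measurableT ip (integrable_exponential_pdf (@ltr01 R)).
  by apply: eq_integrable.
have ih0 : (@mu R).-integrable `]0, +oo[ (EFin \o h) by apply: integrableS ih.
apply: (le_integrable _ _ _ ih0) => //.
- apply/measurable_EFinP; apply: measurable_funTS; apply: measurable_funM.
    exact: measurable_powR.
  by apply: measurableT_comp.
- move=> x /=; rewrite in_itv/= andbT => x0.
  have pe : 0 <= exponential_pdf 1 x by exact: exponential_pdf_ge0.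
  have pp : 0 <= ((@powR R ^~ (a - 1)) \_ `]0, 1[) x.
    by apply: restrict_ge0 => ? _; exact: powR_ge0.
  rewrite lee_fin !ger0_norm ?addr_ge0 ?mulr_ge0 ?powR_ge0 ?expR_ge0//.
  have [x1|x1] := ltP x 1.
    rewrite /h (@le_trans _ _ (x `^ (a - 1)))//.
      by rewrite ler_piMr ?powR_ge0// expR_le1; lra.
    by rewrite patchE mem_set/= ?in_itv/= ?x0 ?x1// lerDl.
  rewrite /h (@le_trans _ _ (exponential_pdf 1 x)) ?lerDr//.
  rewrite exponential_pdfE ?(ltW x0)// mul1r mulN1r.
  by rewrite ler_piMl ?expR_ge0// powR_sub1_le1.
Qed.

Lemma Gamma_gt0 a : 0 < a <= 1 -> 0 < Gamma a.
Proof.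
move=> a01; have /andP[a0 a1] := a01; have iG := integrable_Gamma a01.
have gG x : 0 <= x `^ (a - 1) * expR (- x) by rewrite mulr_ge0// ?powR_ge0 ?expR_ge0.
have := @Rintegral_itvB _ _ (BRight 0) +oo%O 1 iG.
rewrite !bnd_simp => /(_ ler01 isT) /eqP; rewrite subr_eq => /eqP /= E.
rewrite /Gamma E ltr_wpDl ?Rintegral_ge0//.
apply: (@lt_le_trans _ _ (\int[mu]_(x in `]0%R, 1%R]) (expR (-1)))).
  rewrite Rintegral_cst//= lebesgue_measure_itv/= lte_fin ltr01 oppr0 adde0/=.
  by rewrite mulr1 expR_gt0.
apply: le_Rintegral => //=.
- apply: measurable_bounded_integrable => //.
    by rewrite /= lebesgue_measure_itv/= lte_fin ltr01 -EFinB ltry.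
  exact: bounded_cst.
- by apply: integrableS iG => //; exact: subset_itvl.
move=> x; rewrite in_itv/= => /andP[x0 x1].
rewrite (@le_trans _ _ (expR (- x)))// ?ler_expR ?lerN2//.
by rewrite ler_peMl ?expR_ge0// powR_sub1_ge1.
Qed.

End kernel.

(** * Primitives of periodic functions *)

Section periodic.
Context {R : realType}.
Implicit Types (f F : R -> R) (c x y T : R).

Lemma integrable_continuous f x y : continuous f ->
  (@mu R).-integrable `[x, y] (EFin \o f).
Proof.
move=> cf; apply: continuous_compact_integrable; first exact: segment_compact.
exact: continuous_subspaceT.
Qed.

Lemma Rintegral_segmentB f c x y : continuous f -> c <= x -> x <= y ->
  \int[mu]_(t in `[c, y]) f t - \int[mu]_(t in `[c, x]) f t =
  \int[mu]_(t in `[x, y]) f t.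
Proof.
move=> cf cx xy; rewrite Rintegral_itvB ?bnd_simp//.
  rewrite Rintegral_itv_obnd_cbnd//.
  apply: integrableS (integrable_continuous x y cf) => //.
  by apply: subset_itvr; rewrite bnd_simp.
exact: integrable_continuous.
Qed.

(** The primitive is the oriented integral from 0 to x, written as a difference of
    two integrals one of which is always 0. To differentiate it at x, compare it
    with the integral from a base point c below both x and 0, to which the first
    fundamental theorem applies. *)
Lemma continuous_primitive f : continuous f ->
  exists F, forall x, is_derive x 1 F (f x).
Proof.
move=> cf.
pose F x := \int[mu]_(t in `[0, x]) f t - \int[mu]_(t in `[x, 0]) f t.
exists F => x.
pose c := Num.min x 0 - 1.
have cx : c < x by rewrite ltrBlDr gt_min; apply/orP; left; lra.
have c0 : c < 0 by rewrite ltrBlDr gt_min; apply/orP; right; lra.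
pose G y := \int[mu]_(t in `[c, y]) f t.
have FG y : c < y -> F y = G y - G 0.
  move=> cy; rewrite /F /G; have [y0|y0] := leP 0 y.
    rewrite (Rintegral_segmentB cf (ltW c0) y0).
    suff -> : \int[mu]_(t in `[y, 0]) f t = 0 by rewrite subr0.
    move: y0; rewrite le_eqVlt => /predU1P[<-|y0].
      by rewrite set_itv1 Rintegral_set1.
    by rewrite set_itv_ge ?Rintegral_set0// -leNgt bnd_simp.
  rewrite -[RHS]opprB (Rintegral_segmentB cf (ltW cy) (ltW y0)).
  by rewrite set_itv_ge ?Rintegral_set0 ?sub0r// -leNgt bnd_simp.
have [dG G'] : derivable G x 1 /\ G^`()%classic x = f x.
  apply: (@continuous_FTC1_closed _ f c x (x + 1)) => //.
  - by rewrite ltrDl.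
  - exact: integrable_continuous.
  - exact: cf.
have dGx : is_derive x 1 G (f x).
  by apply: DeriveDef; [exact: dG|rewrite -derive1E; exact: G'].
apply: (@near_eq_is_derive _ _ _ (fun y => G y - G 0)).
  near=> y; apply/esym/FG; near: y; exact: lt_nbhsr.
by apply: is_derive_eq; rewrite subr0.
Unshelve. all: by end_near. Qed.

Lemma continuous_periodic_bounded f T : 0 < T -> continuous f ->
  periodic f T -> exists M, forall x, `|f x| <= M.
Proof.
move=> T0 cf pf.
have [c _ fc] : exists2 c, c \in `[0, T] &
    forall t, t \in `[0, T] -> `|f t| <= `|f c|.
  apply: (@EVT_max _ (fun x => `|f x|)); first exact: ltW.
  apply: continuous_subspaceT => x; apply: cvg_norm; exact: cf.
exists `|f c| => x.
pose n := Num.floor (x / T).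
have /andP[nx xn] := floor_itv (x / T).
have -> : f x = f (x - T *~ n).
  rewrite -/n; case: n => m.
    by rewrite -(periodicn pf m (x - T *~ m)) pmulrn subrK.
  by rewrite NegzE mulrNz opprK -pmulrn (periodicn pf).
apply: fc; rewrite in_itv/= -mulrzl; apply/andP; split.
  by rewrite subr_ge0 -ler_pdivlMr.
rewrite lerBlDl -[X in _ + X]mul1r -mulrDl -ler_pdivrMr//.
by rewrite (le_trans (ltW xn))// rmorphD.
Qed.

(** F (x + T) - F x has derivative f (x + T) - f x = 0, so it is constant, and at
    x = 0 it is the integral of f over one period. *)
Lemma periodic_primitive f F T : 0 < T -> continuous f ->
  (forall x, is_derive x 1 F (f x)) -> periodic f T ->
  \int[mu]_(t in `[0, T]) f t = 0 -> periodic F T.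
Proof.
move=> T0 cf dF pf f0 x.
have FT : F T = F 0.
  apply/eqP; rewrite -subr_eq0; apply/eqP; rewrite -[RHS]f0.
  have := @integral_is_derive _ F f 0 T (ltW T0) (fun z _ => dF z)
    (continuous_subspaceT cf).
  by rewrite /Rintegral => ->.
pose G x := F (x + T) - F x.
suff : G x = G 0 by rewrite /G add0r FT subrr => /subr0_eq.
apply: is_derive_0_is_cst => y.
have dshift : is_derive y 1 (fun x : R => x + T) 1.
  by apply: is_derive_eq; rewrite addr0.
have dFT : is_derive y 1 (fun x => F (x + T)) (f (y + T) * 1).
  exact: (is_derive1_comp (f := F) (g := fun x : R => x + T)).
have dFy := dF y.
by apply: is_derive_eq; rewrite pf mulr1 subrr.
Qed.

End periodic.

(** * Bounds on kernel integrals *)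

Section estimates.
Context {R : realType}.
Implicit Types (f k F : R -> R) (a c s t x y A B M : R).

Lemma bounded_onP (S : Type) (A : set S) (u : S -> R) :
  [bounded u z | z in A] <-> exists M, forall z, A z -> `|u z| <= M.
Proof.
split=> [[M [_ uM]]|[M uM]].
  by exists (M + 1) => z; apply: uM; rewrite ltrDl.
exists M; split=> [|N MN z Az]; first exact: num_real.
by rewrite /= (le_trans (uM z Az))// ltW.
Qed.

Lemma integrable_mulrl d (S : measurableType d)
    (nu : {measure set S -> \bar R}) (D : set S) (c : R) (u : S -> R) :
  measurable D -> nu.-integrable D (EFin \o u) ->
  nu.-integrable D (EFin \o (fun z => c * u z)).
Proof. by move=> mD iu; have := integrableZl mD c iu; apply: eq_integrable. Qed.

Lemma normr_Rintegral_le d (S : measurableType d)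
    (nu : {measure set S -> \bar R}) (D : set S) (u v : S -> R) :
  measurable D ->
  nu.-integrable D (EFin \o u) -> nu.-integrable D (EFin \o v) ->
  (forall z : S, D z -> `|u z| <= v z) ->
  `|\int[nu]_(z in D) u z| <= \int[nu]_(z in D) v z.
Proof.
move=> mD ui vi uv; rewrite (le_trans (le_normr_Rintegral mD ui))//.
by apply: le_Rintegral => //; exact: integrable_norm.
Qed.

Lemma integrable_powR_subM f a c t M : 0 < a -> c < t ->
  continuous f -> (forall x, `|f x| <= M) ->
  (@mu R).-integrable `]c, t[ (EFin \o (fun s => (t - s) `^ (a - 1) * f s)).
Proof.
move=> a0 ct cf fM.
apply: (integrableMl _ (integrable_powR_sub a0 ct)) => //.
  by apply: measurable_funTS; exact: continuous_measurable_fun.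
by apply/bounded_onP; exists M => x _; exact: fM.
Qed.

Lemma normr_Rintegral_powR_subM_le f a c t M : 0 < a -> c < t ->
  continuous f -> (forall x, `|f x| <= M) ->
  `|\int[mu]_(s in `]c, t[) ((t - s) `^ (a - 1) * f s)|
    <= M * ((t - c) `^ a / a).
Proof.
move=> a0 ct cf fM.
have M0 : 0 <= M := le_trans (normr_ge0 _) (fM 0).
have ik := integrable_powR_sub a0 ct.
have iMk : (@mu R).-integrable `]c, t[
    (EFin \o (fun s => M * (t - s) `^ (a - 1))).
  exact: integrable_mulrl ik.
apply: (@le_trans _ _ (\int[mu]_(s in `]c, t[) (M * (t - s) `^ (a - 1)))).
  apply: normr_Rintegral_le => //.
    exact: integrable_powR_subM cf fM.
  by move=> x _; rewrite normrM ger0_norm ?powR_ge0// mulrC ler_wpM2r ?powR_ge0.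
by rewrite RintegralZl// ler_wpM2l// Rintegral_powR_sub_le.
Qed.

(** A form of the second mean value theorem: a monotone weight k against an
    oscillating f is controlled by the bound on a primitive of f and the largest
    value of k, however long the interval. By parts, the boundary terms are at
    most M k(y) and M k(x), and the remaining integral at most M (k y - k x)
    because k' is nonnegative. *)
Lemma normr_Rintegral_monotoneM_le k k' f F x y M : x <= y ->
  (forall z : R, x <= z <= y -> is_derive z 1 k (k' z)) ->
  {within `[x, y], continuous k'} ->
  (forall z : R, x <= z <= y -> 0 <= k' z) -> 0 <= k x ->
  continuous f -> (forall z : R, is_derive z 1 F (f z)) ->
  (forall z : R, `|F z| <= M) ->
  `|\int[mu]_(s in `[x, y]) (k s * f s)| <= 2 * M * k y.
Proof.
rewrite le_eqVlt => /predU1P[<-|xy] dk ck' k'0 kx0 cf dF FM.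
  rewrite set_itv1 Rintegral_set1 normr0.
  by rewrite !mulr_ge0// (le_trans (normr_ge0 _) (FM 0)).
have cFs : {within `[x, y], continuous F}.
  by apply: continuous_subspaceT => z; exact: is_derive_continuous (dF z).
have ik' : (@mu R).-integrable `[x, y] (EFin \o k').
  by apply: continuous_compact_integrable => //; exact: segment_compact.
have Ik' : \int[mu]_(s in `[x, y]) k' s = k y - k x.
  by have := integral_is_derive (ltW xy) dk ck'; rewrite /Rintegral => ->.
rewrite (Rintegration_by_parts xy ck' (is_derive_LRcontinuous (ltW xy) dk)
  (is_derive_derive1 dk) (continuous_subspaceT cf)
  (is_derive_LRcontinuous (ltW xy) (fun z _ => dF z))
  (is_derive_derive1 (fun z _ => dF z))).
have Ik'F : `|\int[mu]_(s in `[x, y]) (k' s * F s)| <= M * (k y - k x).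
  rewrite -Ik' -RintegralZl//; apply: normr_Rintegral_le => //.
  - apply: continuous_compact_integrable; first exact: segment_compact.
    by move=> z; apply: cvgM; [exact: ck'|exact: cFs].
  - by apply: integrable_mulrl ik'.
  - move=> z; rewrite /= in_itv/= => zxy.
    by rewrite normrM ger0_norm ?k'0// mulrC ler_wpM2r ?k'0.
have kxy : 0 <= k y - k x.
  by rewrite -Ik'; apply: Rintegral_ge0 => z; rewrite /= in_itv/= => /k'0.
have nk z : 0 <= k z -> `|k z * F z| <= M * k z.
  by move=> kz; rewrite normrM ger0_norm// mulrC ler_wpM2r.
rewrite (le_trans (ler_normB _ _))//.
have := nk y; have := nk x kx0; have := ler_normB (k y * F y) (k x * F x).
have ky0 : 0 <= k y by lra.
by move=> ? ? /(_ ky0) ?; lra.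
Qed.

(** The bound does not depend on t: the last unit of time contributes at most
    A / a, and everything before it at most 2 B. *)
Lemma normr_fractional_integral_le a f F A B t : 0 < a < 1 -> 0 < t ->
  continuous f -> (forall x, `|f x| <= A) ->
  (forall x, is_derive x 1 F (f x)) -> (forall x, `|F x| <= B) ->
  `|\int[mu]_(s in `]0, t[) ((t - s) `^ (a - 1) * f s)| <= A / a + 2 * B.
Proof.
move=> /andP[a0 a1] t0 cf fA dF FB.
have A0 : 0 <= A := le_trans (normr_ge0 _) (fA 0).
have B0 : 0 <= B := le_trans (normr_ge0 _) (FB 0).
have [t1|t1] := leP t 1.
  rewrite (le_trans (normr_Rintegral_powR_subM_le a0 t0 cf fA))//.
  rewrite subr0 mulrA -[leLHS]addr0 lerD ?mulr_ge0// ler_pM2r ?invr_gt0//.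
  by rewrite ler_piMr//; have := @powR_le_mono _ a t 1; rewrite powR1; apply; lra.
have tt1 : t - (t - 1) = 1 by lra.
have iKf := integrable_powR_subM a0 t0 cf fA.
(* Cut at distance 1 from the singularity, where the kernel has the value 1. *)
have := @Rintegral_itvB _ _ (BRight 0) (BLeft t) (t - 1) iKf.
rewrite !bnd_simp => /(_ _ _)/eqP; rewrite subr_eq => /(_ _ _)/eqP ->; [|lra|lra].
rewrite (le_trans (ler_normD _ _))// lerD//.
  have t1t : t - 1 < t by lra.
  have := normr_Rintegral_powR_subM_le a0 t1t cf fA.
  by rewrite tt1 powR1 mul1r.
rewrite Rintegral_itv_obnd_cbnd; last first.
  by apply: integrableS iKf => //; apply: subset_itvl; rewrite bnd_simp; lra.
have -> : 2 * B = 2 * B * (t - (t - 1)) `^ (a - 1).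
  by rewrite tt1 powR1 mulr1.
apply: (@normr_Rintegral_monotoneM_le (fun s => (t - s) `^ (a - 1))
  (fun s => - ((a - 1) * (t - s) `^ (a - 1 - 1))) f F) => //.
- lra.
- by move=> z z1; apply: is_derive_powR_sub; lra.
- apply: derivable_within_continuous => z; rewrite in_itv/= => z1.
  have zt : z < t by lra.
  have dp := is_derive_powR_sub (a - 1 - 1) zt.
  exact: ex_derive.
- move=> z _; rewrite -mulNr mulr_ge0 ?powR_ge0//; lra.
- exact: powR_ge0.
Qed.

End estimates.

(** * Boundedness of the fractional integral *)

Theorem theorem8 (R : realType) (T : R) (f : R -> R) (a : R)
  (T_gt0 : 0 < T) (f_cont : continuous f) (f_per : periodic f T)
  (a_in01 : 0 < a < 1) :
  [bounded frac_integral a f t | t in `]0, +oo[] <->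
  \int[lebesgue_measure]_(t in `[0, T]) f t = 0.
Proof.
have /andP[a0 a1] := a_in01.
have a01 : 0 < a <= 1 by rewrite a0 ltW.
have G0 := Gamma_gt0 a01.
have zero_mean g : continuous g -> periodic g T ->
    \int[mu]_(t in `[0, T]) g t = 0 ->
    exists C, forall t, 0 < t ->
      `|\int[mu]_(s in `]0, t[) ((t - s) `^ (a - 1) * g s)| <= C.
  move=> cg pg g0; have [F dF] := continuous_primitive cg.
  have [A gA] := continuous_periodic_bounded T_gt0 cg pg.
  have cF : continuous F by move=> x; exact: is_derive_continuous (dF x).
  have [B FB] := continuous_periodic_bounded T_gt0 cF
    (periodic_primitive T_gt0 cg dF pg g0).
  exists (A / a + 2 * B) => t t0.
  exact: (normr_fractional_integral_le a_in01 t0 cg gA dF FB).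
split; last first.
  move=> f0; have [C fC] := zero_mean f f_cont f_per f0.
  apply/bounded_onP; exists ((Gamma a)^-1 * C) => t; rewrite /= in_itv/= andbT => t0.
  by rewrite /frac_integral normrM gtr0_norm ?invr_gt0// ler_pM2l ?invr_gt0// fC.
move=> /bounded_onP[B fB].
pose m := T^-1 * \int[mu]_(t in `[0, T]) f t.
pose g x := f x - m.
have cg : continuous g by move=> x; apply: cvgB; [exact: f_cont|exact: cvg_cst].
have pg : periodic g T by move=> x; rewrite /g f_per.
have icst x : (@mu R).-integrable `[0, T] (EFin \o fun=> x).
  by apply: integrable_continuous => ?; exact: cvg_cst.
have g0 : \int[mu]_(t in `[0, T]) g t = 0.
  rewrite RintegralB//; last exact: integrable_continuous.
  rewrite Rintegral_cst//= lebesgue_measure_itv/= lte_fin T_gt0 oppr0 addr0/=.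
  by rewrite /m mulrAC mulVf ?gt_eqF// mul1r subrr.
have [C gC] := zero_mean g cg pg g0.
have mt t : 0 < t -> `|m| * t `^ a <= Gamma a * B + C.
  move=> t0.
  have [D gD] := continuous_periodic_bounded T_gt0 cg pg.
  have ik := integrable_powR_sub a0 t0.
  have If : \int[mu]_(s in `]0, t[) ((t - s) `^ (a - 1) * f s) =
      \int[mu]_(s in `]0, t[) ((t - s) `^ (a - 1) * g s) +
      m * \int[mu]_(s in `]0, t[) ((t - s) `^ (a - 1)).
    rewrite -RintegralZl// -RintegralD//.
    - by apply: eq_Rintegral => s _; rewrite /g; ring.
    - exact: integrable_powR_subM cg gD.
    - by apply: integrable_mulrl ik.
  have := fB t; rewrite /= in_itv/= andbT => /(_ t0).
  rewrite /frac_integral normrM gtr0_norm ?invr_gt0// mulrC ler_pdivrMr//.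
  rewrite (mulrC B) => fBt.
  have /(ler_wpM2l (normr_ge0 m)) tI := Rintegral_powR_sub_ge a01 t0.
  rewrite (le_trans tI)//.
  have I0 : 0 <= \int[mu]_(s in `]0, t[) ((t - s) `^ (a - 1)).
    by apply: Rintegral_ge0 => s _; exact: powR_ge0.
  rewrite -(ger0_norm I0) -normrM -[X in `|X|](addKr
    (\int[mu]_(s in `]0, t[) ((t - s) `^ (a - 1) * g s))) -If addrC.
  by rewrite (le_trans (ler_normB _ _))// lerD// gC.
have [m0|m0] := eqVneq m 0.
  by move/eqP: m0; rewrite /m mulf_eq0 invr_eq0 gt_eqF//= => /eqP.
have nm0 : 0 < `|m| by rewrite normr_gt0.
set E := Gamma a * B + C in mt.
(* At t = u^(1/a) the left-hand side of mt is |m| u = |E| + |m| > E. *)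
pose u := `|E| / `|m| + 1.
have u0 : 0 < u by rewrite ltr_wpDl// divr_ge0.
have := mt (u `^ a^-1) (powR_gt0 _ u0).
rewrite -powRrM mulVf ?gt_eqF// powRr1 ?(ltW u0)// /u mulrDr mulr1 mulrC divfK ?gt_eqF//.
by have := ler_norm E; lra.
Qed.
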